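(* Let $q$ be an odd prime power and let $f\in\mathbb{F}_q[x]$ be a dynamically $2$-ordinary polynomial of degree $d$. Let $a\in\mathbb{F}_q$. Then the longest sequence of consecutive squares (or of consecutive non-squares) in $\mathcal{O}_f(a)$ has length $O\left(q^{\frac{2\log_2(d)+1}{2\log_2(d)+2}}\right)$, where the implied constant depends only on $d$.
   Context: $f^n$ denotes the $n$-th iterate of $f$ ($f^0=x$), and $\deg f\geq 2$. $f$ is dynamically $2$-ordinary if for every $n\geq 1$ there is an irreducible factor $g_n\in\mathbb{F}_q[x]$ of $f^n$ with odd multiplicity in $f^n$ such that $g_n$ does not divide $f^i$ for any $0\leq i<n$. $\mathcal{O}_f(a)=\{a,f(a),f^2(a),\dots\}$ is the forward orbit of $a$; $n$ consecutive elements of $\mathcal{O}_f(a)$ means elements $f^i(a),f^{i+1}(a),\dots,f^{i+n-1}(a)$ for some $i\geq 0$. *)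

(* Defs.v *)
From mathcomp Require Import all_boot all_order all_algebra all_field.
From mathcomp Require Import reals exp.

Set Implicit Arguments.
Unset Strict Implicit.
Unset Printing Implicit Defensive.

Import Order.TTheory GRing.Theory Num.Theory.
Local Open Scope ring_scope.

Definition poly_iter (F : fieldType) (f : {poly F}) (n : nat) : {poly F} :=
  iter n (fun g => f \Po g) 'X.

(* For g irreducible and p != 0 there is exactly one such k. *)
Definition has_multiplicity (F : fieldType) (g p : {poly F}) (k : nat) : bool :=
  (g ^+ k %| p) && ~~ (g ^+ k.+1 %| p).

Definition dynamically_2_ordinary (F : fieldType) (f : {poly F}) : Prop :=
  forall n : nat, (1 <= n)%N ->
    exists g : {poly F},
      [/\ irreducible_poly g,
          exists2 k : nat, odd k & has_multiplicity g (poly_iter f n) k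
        & forall i : nat, (i < n)%N -> ~~ (g %| poly_iter f i)].

(* Zero counts as a square. *)
Definition is_square (F : finFieldType) (x : F) : bool :=
  [exists y : F, x == y ^+ 2].

(* The orbit is a set, so the listed elements have to be pairwise distinct;
   otherwise one could run around a cycle of f any number of times. *)
Definition consecutive_in_orbit (F : fieldType) (f : {poly F}) (a : F)
    (s : seq F) : Prop :=
  uniq s /\
  exists i : nat, s = mkseq (fun j => (poly_iter f (i + j)).[a]) (size s).

Definition log2 (R : realType) (x : R) : R := ln x / ln 2.

(* Main.v *)
From HB Require Import structures.
Require Import Defs.
From mathcomp Require Import all_boot all_order all_fingroup all_algebra all_solvable all_field.
From mathcomp Require Import reals exp.
From mathcomp Require Import zify ring lra.

(** Let q = #|F| and let the segment have N terms.  All of the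
    first N - n + 1 of them lie in the set of x such that x, f(x), ...,
    f^(n-1)(x) have the same quadratic character eps, up to one zero.  Expanding
    prod_(j < n) (1 + eps chi(f^j(x))) over the subsets J of {0, ..., n-1} and
    summing over x leaves q + sum_(J <> 0) eps^|J| sum_x chi(g_J(x)) with
    g_J = prod_(j in J) f^j, of degree at most d^n.  The ordinarity hypothesis at
    max J gives g_J an irreducible factor of odd multiplicity, so every inner sum
    is O(d^n sqrt q), and n is chosen with (2d)^n ~ sqrt q.

    The character sum bound is proved by Stepanov's method: if c = (q-1)/2 and
    g(x)^c = a on S, one finds r_j, s_j of small degree, not all zero, such that
    h = sum_j (r_j + s_j g^c) (X - b)^(qj) vanishes to order l ~ sqrt q on S.
    The orders of vanishing are read off the substitution X -> X + g T, under
    which g^c becomes g^c U with U of controlled degree; no divided derivatives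
    are needed.  Finally h <> 0, because the lowest term of h = 0 would give
    r^2 g = g(b) s^2. *)

Import Order.TTheory GRing.Theory Num.Theory.
Local Open Scope ring_scope.

Set Implicit Arguments.
Unset Strict Implicit.
Unset Printing Implicit Defensive.

(** [#|F|] is a power of the characteristic, so this is an iterate of Frobenius; it serves for
    polynomials over [F] in one and in two variables. *)
Lemma exprD_card (F : finFieldType) (A : comNzRingType) (x y : A) :
  [pchar A] =i [pchar F] -> (x + y) ^+ #|F| = x ^+ #|F| + y ^+ #|F|.
Proof.
move=> eqAF; have [p _ pF] := finPcharP F.
apply: exprDn_pchar; rewrite (eq_pnat _ eqAF) (card_pprimeChar pF).
by rewrite pnatX pnatE ?pF //; apply: pcharf_prime pF.
Qed.

(** * The substitution X -> X + f T and orders of vanishing *)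

Section Shift.

Variables (F : fieldType) (f : {poly F}).

(** The inner variable is X, the outer one T. The coefficient of T^k is f^k times the k-th Hasse
    derivative of the argument; the factor f in front of T makes the shift of f divisible by f. *)
Definition shift : {poly F} -> {poly {poly F}} :=
  comp_poly ('X%:P + f%:P * 'X) \o map_poly polyC.

HB.instance Definition _ := GRing.RMorphism.copy shift
  (comp_poly ('X%:P + f%:P * 'X) \o map_poly polyC).

Lemma shiftC c : shift c%:P = c%:P%:P.
Proof. by rewrite /shift /= map_polyC /= comp_polyC. Qed.

Lemma shiftB p r : shift (p - r) = shift p - shift r.
Proof. exact: rmorphB. Qed.

Lemma shiftD p r : shift (p + r) = shift p + shift r.
Proof. exact: rmorphD. Qed.

Lemma shiftM p r : shift (p * r) = shift p * shift r.
Proof. exact: rmorphM. Qed.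

Lemma shiftXn p n : shift (p ^+ n) = shift p ^+ n.
Proof. exact: rmorphXn. Qed.

Lemma shift_sum (I : Type) (s : seq I) (G : I -> {poly F}) :
  shift (\sum_(i <- s) G i) = \sum_(i <- s) shift (G i).
Proof. exact: rmorph_sum. Qed.

Lemma shiftX : shift 'X = 'X%:P + f%:P * 'X.
Proof. by rewrite /shift /= map_polyX comp_polyX. Qed.

Lemma shift_const_dvd p : exists V, shift p = p%:P + f%:P * 'X * V.
Proof.
elim/poly_ind: p => [|p c [V hV]].
  by exists 0; rewrite rmorph0 mulr0 addr0.
exists ((p%:P + f%:P * 'X * V) + V * 'X%:P).
rewrite !(rmorphD, rmorphM) /= hV shiftX shiftC; ring.
Qed.

Lemma horner_shift x p :
  map_poly (horner_eval x) (shift p) = p \Po (x%:P + f.[x]%:P * 'X).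
Proof.
elim/poly_ind: p => [|p c IH]; first by rewrite !rmorph0.
rewrite !(rmorphD, rmorphM) /= shiftX shiftC IH comp_polyC comp_polyX.
by rewrite !(rmorphD, rmorphM) /= !map_polyC map_polyX /= /horner_eval hornerX hornerC.
Qed.

(** This bounds by [D] the degree in which X has weight 1 and T has weight [- e], hence the
    additivity under products. *)
Definition coef_growth (e : nat) (D : nat) (P : {poly {poly F}}) :=
  forall k, (size (P`_k)%R <= D.+1 + k * e)%N.

Lemma coef_growthD e D P Q :
  coef_growth e D P -> coef_growth e D Q -> coef_growth e D (P + Q).
Proof.
move=> hP hQ k; rewrite coefD (leq_trans (size_polyD _ _)) //.
by rewrite geq_max hP hQ.
Qed.

Lemma coef_growthM e D1 D2 P Q :
  coef_growth e D1 P -> coef_growth e D2 Q -> coef_growth e (D1 + D2) (P * Q).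
Proof.
move=> hP hQ k; rewrite coefM (leq_trans (size_sum _ _ _)) //.
apply/bigmax_leqP => i _; rewrite (leq_trans (size_polyMleq _ _)) //.
have := hP i; have := hQ (k - i)%N; have := ltn_ord i.
rewrite ltnS => hi h2 h1.
have -> : (k * e = i * e + (k - i) * e)%N by rewrite -mulnDl subnKC.
lia.
Qed.

Lemma coef_growthW e D1 D2 P :
  (D1 <= D2)%N -> coef_growth e D1 P -> coef_growth e D2 P.
Proof. by move=> h hP k; apply: leq_trans (hP k) _; rewrite leq_add2r ltnS. Qed.

Lemma coef_growthC e (c : {poly F}) : coef_growth e (size c).-1 c%:P.
Proof. by move=> k; rewrite coefC; case: eqP => _; rewrite ?size_poly0; lia. Qed.

Lemma coef_growthX e D P : coef_growth e 0 P -> coef_growth e 0 (P ^+ D).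
Proof.
move=> hP; elim: D => [|D IH].
  by rewrite expr0; have := coef_growthC e 1; rewrite size_poly1.
by rewrite exprS; apply: (@coef_growthM e 0 0).
Qed.

Lemma coef_growth_shift m (p : {poly F}) :
  (size f <= m.+1)%N -> coef_growth m (size p).-1 (shift p).
Proof.
move=> hf; elim/poly_ind: p => [|p c IH].
  by rewrite rmorph0 => k; rewrite coef0 size_poly0.
have hX : coef_growth m 1 (shift 'X).
  move=> k; rewrite shiftX coefD coefC coefMX coefC.
  case: k => [|[|k]] /=; rewrite ?size_polyX ?size_poly0 ?addr0 ?size_polyX //.
    by rewrite add0r mul1n; apply: leq_trans hf _; rewrite ltnS leqnSn.
  by rewrite size_poly0.
have [->|p0] := eqVneq p 0.
  rewrite mul0r add0r shiftC.
  by apply: coef_growthW _ (coef_growthC _ _); rewrite size_polyC; lia.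
rewrite rmorphD rmorphM /= shiftC; apply: coef_growthD.
  apply: coef_growthW _ (coef_growthM IH hX).
  by rewrite size_MXaddC (negPf p0) addn1 prednK ?size_poly_gt0.
by apply: coef_growthW _ (coef_growthC _ _); rewrite size_polyC; lia.
Qed.

(** T occurs only together with f, so f divides its own shift, and the division removes exactly the
    initial degree [m]. Growth from 0 is stable under powers, so the cofactor of f^c in the shift of
    f^c obeys a bound free of c. *)
Lemma shift_unit_factor m : size f = m.+1 ->
  exists2 U, shift f = f%:P * U & coef_growth m 0 U.
Proof.
move=> hf; have [V hV] := shift_const_dvd f; exists (1 + 'X * V).
  by rewrite hV; ring.
move=> k; have : shift f = f%:P * (1 + 'X * V) by rewrite hV; ring.
have /(_ f) := @coef_growth_shift m _ (eq_leq hf) => /(_ k) + hU.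
rewrite hU coefCM hf /=; have [->|h] := eqVneq ((1 + 'X * V)`_k) 0.
  by rewrite size_poly0.
have f0 : f != 0 by rewrite -size_poly_gt0 hf.
by rewrite size_mul // hf addSn /= -[m.+1]addn1 -addnA leq_add2l.
Qed.

(** The vanishing coefficients make T^l divide p(x + f(x) T); as f(x) is nonzero, putting T = (X -
    x) / f(x) recovers p. *)
Lemma shift_high_multiplicity l x p : f.[x] != 0 ->
  (forall k, (k < l)%N -> ((shift p)`_k).[x] = 0) -> ('X - x%:P) ^+ l %| p.
Proof.
move=> fx hk.
have : 'X^l %| p \Po (x%:P + f.[x]%:P * 'X).
  rewrite -horner_shift.
  apply/dvdpP; exists (drop_poly l (map_poly (horner_eval x) (shift p))).
  rewrite -[LHS](poly_take_drop l) [take_poly _ _](_ : _ = 0) ?add0r //.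
  apply/polyP => i; rewrite coef_take_poly coef0; case: ifP => // il.
  by rewrite coef_map /= /horner_eval hk.
move/(dvdp_comp_poly ((f.[x]^-1)%:P * ('X - x%:P))).
rewrite -comp_polyA comp_polyD comp_polyM !comp_polyC comp_polyX mulrA -polyCM.
rewrite mulfV // mul1r [x%:P + _]addrC subrK comp_polyXr rmorphXn /= comp_polyX exprMn.
by rewrite -polyC_exp mul_polyC dvdpZl // expf_neq0 // invr_neq0.
Qed.

End Shift.

(** * Stepanov's method *)

(** Pigeonhole: two distinct elements with the same image differ by a kernel element. Sizes of
    finite groups take the place of dimensions. *)
Lemma additive_kernel (U V : finZmodType) (L : U -> V) :
  {morph L : x y / x - y} -> (#|V| < #|U|)%N ->
  exists2 u, u != 0 & L u = 0.
Proof.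
move=> hL; rewrite ltnNge => hc.
have /injectivePn[x [y xy exy]] : ~~ injectiveb L.
  by apply: contra hc => /injectiveP; apply: leq_card.
by exists (x - y); rewrite ?subr_eq0 // hL exy subrr.
Qed.

Lemma prod_XsubC_exp_dvd (F : fieldType) (l : nat) (h : {poly F}) (s : seq F) :
  uniq s -> {in s, forall x, ('X - x%:P) ^+ l %| h} ->
  (\prod_(x <- s) ('X - x%:P)) ^+ l %| h.
Proof.
elim: s => [|x s IH] /=; first by rewrite big_nil expr1n dvd1p.
move=> /andP[xs us] hs; rewrite big_cons exprMn Gauss_dvdp.
  rewrite hs ?mem_head //; apply: IH => // y ys.
  by apply: hs; rewrite inE ys orbT.
apply/coprimep_expl/coprimep_expr; rewrite coprimep_sym coprimep_XsubC.
by rewrite root_prod_XsubC.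
Qed.

(** With denominators cleared: [p] is not a constant times the square of a rational function. *)
Definition nonsquare_class (F : fieldType) (p : {poly F}) :=
  forall (r s : {poly F}) (c : F), r ^+ 2 * p = c *: s ^+ 2 -> r = 0.

Section Stepanov.

Variables (F : finFieldType) (f : {poly F}) (m : nat).
Hypotheses (Fodd : odd #|F|) (sf : size f = m.+1) (nsf : nonsquare_class f).

Let q := #|F|.
Let c := q.-1./2.

Let q_gt1 : (1 < q)%N. Proof. exact: finNzRing_gt1. Qed.

Let dbl_c : (c + c = q.-1)%N.
Proof.
rewrite addnn; apply: even_halfK; move: Fodd q_gt1; rewrite /q.
by case: #|F| => //= n /negPf ->.
Qed.

Variables (a b : F) (J A l : nat).
Hypotheses (a0 : a != 0) (fb : f.[b] != 0).
Hypotheses (A0 : (0 < A)%N) (lq : (l <= q)%N).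
Hypotheses (Aq : (A + A + m <= q)%N).
Hypotheses (dim : (l * (A + l * m + J) < (J + J) * A)%N).

Implicit Types M : 'M[F]_(J + J, A).

(** One matrix packs all the unknown polynomials, giving a finite group whose size counts the 2 J A
    free coefficients. *)
Let rpart M (j : 'I_J) : {poly F} := rVpoly (row (lshift J j) M).
Let spart M (j : 'I_J) : {poly F} := rVpoly (row (rshift J j) M).

Let auxiliary M : {poly F} :=
  \sum_(j < J) (rpart M j + spart M j * f ^+ c) * (('X - b%:P) ^+ q) ^+ j.

(** For U = U1^c and k < q this stands in for the coefficient of T^k in the shift of [auxiliary M]:
    f^c is replaced by [a] and (X - b)^q by X - b, which changes no value at points of F where f^c =
    a. The degree becomes small, so that asking for the zero polynomial is affordable. *)
Let sigma (U : {poly {poly F}}) k M : {poly F} :=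
  \sum_(j < J) ((shift f (rpart M j))`_k + a *: (shift f (spart M j) * U)`_k)
                * ('X - b%:P) ^+ j.

Let size_rpart M j : (size (rpart M j) <= A)%N.
Proof. exact: size_poly. Qed.

Let size_spart M j : (size (spart M j) <= A)%N.
Proof. exact: size_poly. Qed.

Let sigmaB U k : {morph sigma U k : M N / M - N}.
Proof.
move=> M N; rewrite /sigma -sumrB; apply: eq_bigr => j _.
have rowB i : rVpoly (row i (M - N)) = rVpoly (row i M) - rVpoly (row i N).
  by rewrite 2!linearB.
rewrite /rpart /spart !rowB !shiftB mulrBl.
rewrite !coefB scalerBr -mulrBl.
by congr (_ * _); rewrite opprD addrACA.
Qed.

Let size_sigma U k M : coef_growth m 0 U -> (k < l)%N ->
  (size (sigma U k M) <= A + l * m + J)%N.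
Proof.
move=> hU kl; apply: leq_trans (size_sum _ _ _) _; apply/bigmax_leqP => j _.
apply: leq_trans (size_polyMleq _ _) _; rewrite size_exp_XsubC addnS /=.
apply: leq_add (ltnW (ltn_ord j)).
have growth (p : {poly F}) : (size p <= A)%N -> coef_growth m A.-1 (shift f p).
  move=> hp; apply: coef_growthW (coef_growth_shift p (eq_leq sf)).
  by rewrite -!subn1 leq_sub2r.
have bound : (A.-1.+1 + k * m <= A + l * m)%N.
  by rewrite prednK // leq_add2l leq_mul2r ltnW ?orbT.
apply: leq_trans (size_polyD _ _) _; rewrite geq_max; apply/andP; split.
  exact: leq_trans (growth _ (size_rpart M j) k) bound.
apply: leq_trans (size_scale_leq _ _) _.
have := coef_growthM (growth _ (size_spart M j)) hU; rewrite addn0 => /(_ k).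
by move/leq_trans; apply.
Qed.

(** Each of the [l] conditions costs at most A + l m + J coefficients, and by [dim] the matrix has
    more free entries than they cost in total. *)
Lemma stepanov_kernel U : coef_growth m 0 U ->
  exists2 M, M != 0 & forall k, (k < l)%N -> sigma U k M = 0.
Proof.
move=> hU; pose B := (A + l * m + J)%N.
pose L M : 'M[F]_(l, B) := \matrix_(k < l, i < B) (sigma U k M)`_i.
have hL : {morph L : M N / M - N}.
  by move=> M N; apply/matrixP => k i; rewrite !mxE sigmaB coefB.
have hcard : (#|{: 'M[F]_(l, B)}| < #|{: 'M[F]_(J + J, A)}|)%N.
  by rewrite !card_mx ltn_exp2l.
have [M M0 hM] := additive_kernel hL hcard; exists M => // k kl.
apply/polyP => i; rewrite coef0; have [iB|iB] := ltnP i B.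
  by move/matrixP/(_ (Ordinal kl) (Ordinal iB)): hM; rewrite !mxE.
by apply: nth_default; apply: leq_trans iB; apply: size_sigma.
Qed.

Let coef_shift_powers (P : {poly {poly F}}) (u v : {poly F}) j k : (k < q)%N ->
  (P * (u%:P + v%:P * 'X^q) ^+ j)`_k = P`_k * u ^+ j.
Proof.
move=> kq; elim: j P => [|j IH] P; first by rewrite !expr0 !mulr1.
rewrite exprS mulrA IH mulrDr coefD coefMC mulrA coefMXn kq addr0 exprS.
by rewrite mulrA.
Qed.

(** By Frobenius the dependence on T starts only at T^q, so below that order powers of (X - b)^q
    behave as constants. *)
Let shift_center :
  shift f (('X - b%:P) ^+ q) = (('X - b%:P) ^+ q)%:P + (f ^+ q)%:P * 'X^q.
Proof.
rewrite shiftXn shiftB shiftX shiftC addrAC -rmorphB /= exprD_card.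
  by rewrite exprMn !rmorphXn.
by move=> p; rewrite !pchar_poly.
Qed.

Lemma shift_auxiliary U1 M k x : shift f f = f%:P * U1 -> f.[x] ^+ c = a ->
  (k < q)%N -> ((shift f (auxiliary M))`_k).[x] = (sigma (U1 ^+ c) k M).[x].
Proof.
move=> hU1 fx kq; rewrite /auxiliary /sigma shift_sum coef_sum !horner_sum.
apply: eq_bigr => j _; rewrite shiftM [shift f (_ ^+ _)]shiftXn shift_center coef_shift_powers //.
rewrite !hornerM; congr (_ * _); last first.
  by rewrite !horner_exp hornerXsubC -exprM mulnC exprM expf_card.
rewrite shiftD shiftM shiftXn hU1 exprMn mulrCA -rmorphXn /=.
by rewrite coefD coefCM !hornerE fx.
Qed.

Let combination_eq0 (r s : {poly F}) : (size r <= A)%N -> (size s <= A)%N ->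
  ('X - b%:P) ^+ q %| r + s * f ^+ c -> r = 0 /\ s = 0.
Proof.
move=> sr ss hdvd.
have sq (p : {poly F}) : (size p <= A)%N -> (size (p ^+ 2) < A + A)%N.
  move=> hp; rewrite expr2; apply: leq_ltn_trans (size_polyMleq _ _) _.
  apply: (@leq_ltn_trans (A + A).-1); last by rewrite prednK // addn_gt0 A0.
  by rewrite -!subn1 leq_sub2r // leq_add.
(* By Frobenius, f ^+ q is f.[b] plus a multiple of ('X - b) ^+ q, so the given
   congruence multiplied by its conjugate no longer involves f ^+ c. *)
have fq : ('X - b%:P) ^+ q %| f ^+ q - (f.[b])%:P.
  have /factor_theorem[w hw] : root (f - (f.[b])%:P) b.
    by rewrite rootE !hornerE subrr.
  have -> : f ^+ q - (f.[b])%:P = (f - (f.[b])%:P) ^+ q.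
    rewrite -{1}[f](subrK (f.[b])%:P) exprD_card.
      by rewrite -[_%:P ^+ _]rmorphXn /= expf_card addrK.
    by move=> p; rewrite pchar_poly.
  by rewrite hw exprMn dvdp_mull.
have key : ('X - b%:P) ^+ q %| r ^+ 2 * f - f.[b] *: s ^+ 2.
  have -> : r ^+ 2 * f - f.[b] *: s ^+ 2 =
     (r + s * f ^+ c) * (r - s * f ^+ c) * f + s ^+ 2 * (f ^+ q - (f.[b])%:P).
    have -> : f ^+ q = f ^+ c * f ^+ c * f.
      by rewrite -exprD dbl_c -exprSr prednK // ltnW.
    by rewrite -mul_polyC; ring.
  by apply: dvdp_add; [rewrite -mulrA dvdp_mulr | rewrite dvdp_mull].
(* By [Aq] both sides have size at most q, less than the size q + 1 of (X - b)^q, so divisibility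
   forces equality. *)
have eq0 : r ^+ 2 * f = f.[b] *: s ^+ 2.
  apply/eqP; rewrite -subr_eq0; apply: contraLR key => n0.
  apply/negP => /(dvdp_leq n0); rewrite size_exp_XsubC ltnNge => /negP; apply.
  apply: leq_trans (size_polyD _ _) _; rewrite size_polyN geq_max.
  apply/andP; split.
    apply: leq_trans (size_polyMleq _ _) _; rewrite sf addnS /=.
    apply: leq_trans Aq; rewrite leq_add2r ltnW //; exact: sq.
  apply: leq_trans (size_scale_leq _ _) _; apply: leq_trans (ltnW (sq _ ss)) _.
  by apply: leq_trans Aq; rewrite leq_addr.
have r0 := nsf eq0; split=> //.
move/eqP: eq0; rewrite r0 expr0n mul0r eq_sym scaler_eq0 (negPf fb) /=.
by rewrite expf_eq0 => /eqP.
Qed.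

(** Induction on the number of terms: modulo (X - b)^q only the lowest term survives,
    [combination_eq0] kills it, and one factor (X - b)^q cancels from the rest. *)
Lemma auxiliary_neq0 M : M != 0 -> auxiliary M != 0.
Proof.
apply: contraNneq => h0.
suff zero n (r s : 'I_n -> {poly F}) :
    (forall j, size (r j) <= A)%N -> (forall j, size (s j) <= A)%N ->
    \sum_(j < n) (r j + s j * f ^+ c) * (('X - b%:P) ^+ q) ^+ j = 0 ->
    forall j, r j = 0 /\ s j = 0.
  have /zero := h0 => /(_ (size_rpart M) (size_spart M)) hz.
  apply/eqP/matrixP => i k; rewrite mxE.
  case: (split_ordP i) => j ->; have [hr hs] := hz j.
    by have := coef_rVpoly_ord (row (lshift J j) M) k; rewrite -/(rpart M j) hr coef0 mxE.
  by have := coef_rVpoly_ord (row (rshift J j) M) k; rewrite -/(spart M j) hs coef0 mxE.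
elim: n r s => [|n IH] r s hr hs; first by move=> _ [].
rewrite big_ord_recl expr0 mulr1 => hsum.
set Z := ('X - b%:P) ^+ q in hsum.
pose T := \sum_(j < n)
  (r (lift ord0 j) + s (lift ord0 j) * f ^+ c) * Z ^+ j.
have {}hsum : r ord0 + s ord0 * f ^+ c + T * Z = 0.
  rewrite -[RHS]hsum; congr (_ + _); rewrite mulr_suml; apply: eq_bigr => j _.
  by rewrite -mulrA -exprSr.
have [r0 s0] : r ord0 = 0 /\ s ord0 = 0.
  apply: combination_eq0 => //; have /eqP := hsum; rewrite addr_eq0 => /eqP ->.
  by rewrite dvdpNr dvdp_mull.
have T0 : T = 0.
  move/eqP: hsum; rewrite r0 s0 mul0r !add0r mulf_eq0 => /orP[/eqP //|].
  by rewrite expf_eq0 polyXsubC_eq0 andbF.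
move=> j; have [j' ->|->] := unliftP ord0 j; last by [].
exact: (IH (fun j => r (lift ord0 j)) (fun j => s (lift ord0 j))).
Qed.

Let size_auxiliary M : (size (auxiliary M) <= A + m * c + q * J)%N.
Proof.
apply: leq_trans (size_sum _ _ _) _; apply/bigmax_leqP => j _.
apply: leq_trans (size_polyMleq _ _) _; rewrite -exprM size_exp_XsubC addnS /=.
apply: leq_add; last by rewrite leq_mul2l ltnW ?orbT.
apply: leq_trans (size_polyD _ _) _; rewrite geq_max; apply/andP; split.
  by apply: leq_trans (size_rpart M j) _; rewrite leq_addr.
apply: leq_trans (size_polyMleq _ _) _.
have := size_poly_exp_leq f c; rewrite sf /= => hfc.
have := leq_add (size_spart M j) hfc; rewrite addnS.
by case: (_ + _)%N => //= n; rewrite ltnS.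
Qed.

(** A nonzero polynomial vanishing to order [l] on [S] has degree at least l #|S|; the right-hand
    side is the size bound for [auxiliary M]. *)
Lemma stepanov_param (S : {set F}) : (forall x, x \in S -> f.[x] ^+ c = a) ->
  (l * #|S| < A + m * c + q * J)%N.
Proof.
move=> hS; have [U1 hU1 gU1] := shift_unit_factor sf.
have [M M0 hM] := stepanov_kernel (coef_growthX c gU1).
have c0 : (0 < c)%N by rewrite -double_gt0 -addnn dbl_c -subn1 subn_gt0.
have hdvd : (\prod_(x <- enum S) ('X - x%:P)) ^+ l %| auxiliary M.
  apply: prod_XsubC_exp_dvd (enum_uniq _) _ => x; rewrite mem_enum => /hS fx.
  apply: (@shift_high_multiplicity _ f) => [|k kl].
    by apply: contraNneq a0 => f0; rewrite -fx f0 expr0n -leqn0 leqNgt c0.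
  by rewrite (shift_auxiliary M hU1 fx) ?hM ?horner0 // (leq_trans kl).
have := leq_trans (dvdp_leq (auxiliary_neq0 M0) hdvd) (size_auxiliary M).
rewrite -[size _]prednK; last first.
  by rewrite size_poly_gt0 expf_neq0 // monic_neq0 // monic_prod_XsubC.
by rewrite size_exp size_prod_XsubC /= -cardE mulnC.
Qed.

End Stepanov.

Lemma nonsquare_class_degree (F : fieldType) (f : {poly F}) (m : nat) :
  size f = m.+1 -> nonsquare_class f -> (0 < m)%N.
Proof.
case: m => // /eqP/size_poly1P[c c0 ->] /(_ 1 1 c).
rewrite expr1n mul1r -mul_polyC mulr1 => /(_ erefl) /eqP.
by rewrite oner_eq0.
Qed.

(** Taking J near l/2 makes q J / l close to q/2, the expected size of a class. The surplus 4 m in J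
    adds about 8 m (q/4) = 2 m q unknowns, which pay for l^2 m <= m q and for l J. *)
Lemma stepanov_dimension (q l m : nat) : (l * l <= q)%N -> (0 < m)%N -> (32 * m < l)%N ->
  (l * (q %/ 4 + l * m + (l./2 + 4 * m)) < ((l./2 + 4 * m) + (l./2 + 4 * m)) * (q %/ 4))%N.
Proof.
move=> hl hm hml; set A := (q %/ 4)%N; set J := (l./2 + 4 * m)%N.
have hA : (l * l <= 4 * A + 3)%N by rewrite /A; lia.
have hJ1 : (l + 8 * m <= J + J + 1)%N by rewrite /J; lia.
have hJ2 : (J + J <= l + 8 * m)%N by rewrite /J; lia.
clearbody A J; nia.
Qed.

Lemma stepanov (F : finFieldType) (f : {poly F}) (m l : nat) (a : F) :
  odd #|F| -> size f = m.+1 -> nonsquare_class f -> (l * l <= #|F|)%N -> a != 0 ->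
  (2 * l * #|[set x | f.[x] ^+ (#|F|.-1./2) == a]| <= l * #|F| + 32 * m * #|F|)%N.
Proof.
move=> oddF sf nsf hl a0; set S := [set x | _].
have SF : (#|S| <= #|F|)%N by apply: max_card.
(* The constant 32 covers small [l], where #|S| <= q already gives the claim; beyond it the
   parameters of [stepanov_dimension] apply. *)
have [hlm|hlm] := leqP l (32 * m).
  by have := leq_mul hlm (leqnn #|F|); have := leq_mul (leqnn (2 * l)) SF; lia.
have m0 := nonsquare_class_degree sf nsf.
(* Any point of [S] can serve as the centre [b]: there f(b)^c = a is nonzero, hence so is f(b). *)
have [->|/set0Pn[b bS]] := eqVneq S set0; first by rewrite cards0 muln0.
have hS x : x \in S -> f.[x] ^+ (#|F|.-1./2) = a by rewrite inE => /eqP.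
have q1 : (33 * l <= #|F|)%N by nia.
have fb : f.[b] != 0.
  by apply: contraNneq a0 => f0; rewrite -(hS b bS) f0 expf_eq0 eqxx andbT; lia.
have := stepanov_param oddF sf nsf a0 fb _ _ _ (stepanov_dimension hl m0 hlm) hS.
move: q1 hlm; set q := #|F|; set N := #|S| => q1 hlm.
have h1 : (0 < q %/ 4)%N by lia.
have h2 : (l <= q)%N by lia.
have h3 : (q %/ 4 + q %/ 4 + m <= q)%N by lia.
move=> /(_ h1 h2 h3).
have e1 : (m * q.-1./2 + m * q.-1./2 <= m * q)%N by rewrite -mulnDr leq_mul2l; lia.
have e2 : (q * (l./2 + 4 * m) + q * (l./2 + 4 * m) <= q * (l + 8 * m))%N.
  by rewrite -mulnDr leq_mul2l; lia.
have e3 : (q <= m * q)%N by rewrite leq_pmull.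
have e4 : (q %/ 4 <= q)%N by lia.
lia.
Qed.

(** * Quadratic character sums *)

Section QuadraticCharacter.

Variable F : finFieldType.
Hypothesis oddF : odd #|F|.

Let q := #|F|.
Let c := q.-1./2.

Let dbl_c : (c + c = q.-1)%N.
Proof.
rewrite addnn; apply: even_halfK; move: oddF (finNzRing_gt1 F); rewrite /q.
by case: #|F| => //= n /negPf ->.
Qed.

(** Euler's criterion is taken as the definition, so that a character sum is a difference of two
    counts of the kind bounded by [stepanov]. For odd [#|F|] it vanishes at 0, whereas [is_square]
    holds there. *)
Definition quad_char (x : F) : int :=
  (x ^+ (#|F|.-1./2) == 1)%:Z - (x ^+ (#|F|.-1./2) == -1)%:Z.

Lemma oner_neqN1 : (1 : F) != -1.
Proof.
rewrite -subr_eq0 opprK; apply: contraL oddF => /eqP two0.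
have pF : 2 \in [pchar F] by rewrite inE /= mulr2n two0.
have := finNzRing_gt1 F; rewrite (card_pprimeChar pF).
by case: (logn _ _) => // n _; rewrite oddX.
Qed.

Lemma exp_half_card (x : F) : x != 0 -> x ^+ c = 1 \/ x ^+ c = -1.
Proof.
move=> x0; have : (x ^+ c) ^+ 2 == 1.
  rewrite -exprM muln2 -addnn dbl_c -(inj_eq (mulfI x0)) -exprS mulr1.
  by rewrite prednK ?expf_card // /q -/(0 < #|F|)%N ltnW // finNzRing_gt1.
by rewrite sqrf_eq1 => /orP[] /eqP; [left | right].
Qed.

Lemma exp0_half_card : (0 : F) ^+ c = 0.
Proof.
apply/eqP; rewrite expf_eq0 eqxx andbT -double_gt0 -addnn dbl_c.
by rewrite -subn1 subn_gt0 finNzRing_gt1.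
Qed.

Lemma quad_char0 : quad_char 0 = 0.
Proof. by rewrite /quad_char -/q -/c exp0_half_card eq_sym oner_eq0 eq_sym oppr_eq0 oner_eq0. Qed.

Lemma quad_charM : {morph quad_char : x y / x * y}.
Proof.
move=> x y; rewrite /quad_char exprMn -/q -/c.
have cases (z : F) : [\/ z ^+ c = 0, z ^+ c = 1 | z ^+ c = -1].
  have [->|z0] := eqVneq z 0; first by constructor 1; apply: exp0_half_card.
  by case: (exp_half_card z0) => zc; [constructor 2 | constructor 3].
have n1 : (1 == -1 :> F) = false by apply/negbTE; apply: oner_neqN1.
have n2 : (-1 == 1 :> F) = false by rewrite eq_sym.
have n3 : (0 == 1 :> F) = false by rewrite eq_sym oner_eq0.
have n4 : (0 == -1 :> F) = false by rewrite eq_sym oppr_eq0 oner_eq0.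
by case: (cases x) => ->; case: (cases y) => ->;
  rewrite ?(mul0r, mulr0, mul1r, mulr1, mulrNN, n1, n2, n3, n4, eqxx).
Qed.

Lemma is_square_exp (x : F) : x != 0 -> is_square x = (x ^+ c == 1).
Proof.
move=> x0; apply/existsP/eqP => [[y /eqP xy]|xc].
  have y0 : y != 0 by apply: contraNneq x0 => y0; rewrite xy y0 expr0n.
  rewrite xy -exprM mul2n -addnn dbl_c; apply: (mulfI y0).
  by rewrite -exprS prednK ?expf_card ?mulr1 // ltnW // finNzRing_gt1.
have ux : x \is a GRing.unit by rewrite unitfE.
(* The unit group is cyclic of order 2 c: for x = w^k, the equation x^c = 1 says that 2 c divides k
   c, so k is even. *)
have /cyclicP[w hw] := field_unit_group_cyclic [set: {unit F}]%G.
have : FinRing.unit F ux \in <[w]>%g by rewrite -hw inE.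
case/cycleP=> k hk.
have ow : #[w]%g = (c + c)%N by rewrite dbl_c orderE -hw card_finField_unit.
have : (w ^+ (k * c) == 1)%g.
  apply/eqP/val_inj; rewrite FinRing.val_unitX exprM -FinRing.val_unitX -hk /=.
  by rewrite xc.
rewrite -order_dvdn ow addnn -mul2n mulnC.
have c0 : (0 < c)%N.
  by rewrite -double_gt0 -addnn dbl_c -subn1 subn_gt0 finNzRing_gt1.
rewrite mulnC dvdn_pmul2r // => /dvdnP[j hj].
exists (val w ^+ j); rewrite -exprM -hj -FinRing.val_unitX -hk /=.
by [].
Qed.

End QuadraticCharacter.

(** Stepanov's method bounds each class only from above. The two classes together miss at most the
    [m] roots of [g], so an upper bound for one is a lower bound for the other; these roots turn 32
    into 33. *)
Lemma quad_char_sum_bound (F : finFieldType) (g : {poly F}) (m l : nat) :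
  odd #|F| -> size g = m.+1 -> nonsquare_class g -> (l * l <= #|F|)%N ->
  l%:Z * `|\sum_(x : F) quad_char g.[x]| <= (33 * m * #|F|)%:Z.
Proof.
move=> oddF sg nsg hl; set c := #|F|.-1./2.
pose S (e : F) := [set x | g.[x] ^+ c == e].
have sumE : \sum_(x : F) quad_char g.[x] = (#|S 1%R|)%:Z - (#|S (-1)%R|)%:Z.
  have sum_ind e : \sum_(x : F) (g.[x] ^+ c == e)%:Z = (#|S e|)%:Z.
    rewrite -sum1_card -natz natr_sum [RHS]big_mkcond; apply: eq_bigr => x _.
    by rewrite inE; case: eqP.
  by rewrite sumrB !sum_ind.
have hp := stepanov oddF sg nsg hl (oner_neq0 F).
have hn : (2 * l * #|S (-1)%R| <= l * #|F| + 32 * m * #|F|)%N.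
  by apply: stepanov => //; rewrite oppr_eq0 oner_neq0.
have hpn : [disjoint S 1%R & S (-1)%R].
  rewrite -setI_eq0; apply/eqP/setP => x; rewrite !inE; apply/negbTE/negP.
  by move=> /andP[/eqP -> /eqP e]; have /eqP := oner_neqN1 oddF.
have h0 : (#|~: (S 1%R :|: S (-1)%R)| <= m)%N.
  have g0 : g != 0 by rewrite -size_poly_gt0 sg.
  rewrite -ltnS -sg cardE; apply: max_poly_roots (enum_uniq _) => //.
  apply/allP => x; rewrite mem_enum !inE; apply: contraR => gx.
  by have [->|->] := exp_half_card oddF gx; rewrite eqxx ?orbT.
have hq : (#|F| <= #|S 1%R| + #|S (-1)%R| + m)%N.
  by move: hpn; rewrite -leq_card_setU => /eqP <-; rewrite -(cardsC (S 1%R :|: S (-1)%R)) leq_add2l.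
have hlq : (l <= #|F|)%N by nia.
rewrite sumE; move: hp hn hq hlq; rewrite -/c -/(S 1%R).
set p := #|S 1%R|; set n := #|S (-1)%R|; set q := #|F| => hp hn hq hlq.
have e1 : (l * q <= l * p + l * n + l * m)%N by rewrite -!mulnDr leq_mul2l hq orbT.
have e2 : (l * m <= m * q)%N by rewrite mulnC leq_mul2l hlq orbT.
have -> : l%:Z * `|p%:Z - n%:Z| = `|(l * p)%:Z - (l * n)%:Z|.
  by rewrite !PoszM -mulrBr normrM ger0_norm.
rewrite ler_norml; lia.
Qed.

(** * Products of iterates *)

Section Multiplicity.

Variables (F : fieldType) (g : {poly F}).
Hypothesis irrg : irreducible_poly g.

Lemma irreducible_dvdM (p r : {poly F}) : (g %| p * r) = (g %| p) || (g %| r).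
Proof.
apply/idP/orP => [|[]]; [|exact: dvdp_mulr|exact: dvdp_mull].
have [|ngp] := boolP (g %| p); first by left.
by rewrite Gauss_dvdpr ?irreducible_poly_coprime //; right.
Qed.

Lemma has_multiplicityP (p : {poly F}) k :
  reflect (exists2 p', p = p' * g ^+ k & ~~ (g %| p')) (has_multiplicity g p k).
Proof.
have g0 : g ^+ k != 0 by rewrite expf_neq0 // irredp_neq0.
apply: (iffP andP) => [[/dvdpP[p' ->]]|[p' -> np']].
  by rewrite exprS dvdp_mul2r //; exists p'.
by rewrite dvdp_mull // exprS dvdp_mul2r.
Qed.

Lemma has_multiplicityM (p r : {poly F}) k j :
  has_multiplicity g p k -> has_multiplicity g r j ->
  has_multiplicity g (p * r) (k + j).
Proof.
move=> /has_multiplicityP[p' -> np] /has_multiplicityP[r' -> nr].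
apply/has_multiplicityP; exists (p' * r'); first by rewrite exprD mulrACA.
by rewrite irreducible_dvdM negb_or np.
Qed.

Lemma has_multiplicity_uniq (p : {poly F}) k j :
  has_multiplicity g p k -> has_multiplicity g p j -> k = j.
Proof.
wlog lekj : k j / (k <= j)%N.
  move=> hw hk hj; case/orP: (leq_total k j) => /hw; first exact.
  by move/(_ hj hk).
move=> /andP[_ nk] /andP[dj _]; apply/eqP; rewrite eqn_leq lekj leqNgt.
by apply: contra nk => ltkj; apply: dvdp_trans dj; apply: dvdp_exp2l.
Qed.

Lemma has_multiplicity_exists (p : {poly F}) :
  p != 0 -> exists k, has_multiplicity g p k.
Proof.
move=> p0; have sg1 : (1 < size g)%N by case: irrg.
have ex : exists k, ~~ (g ^+ k.+1 %| p).
  exists (size p); apply/negP => /(dvdp_leq p0) hle.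
  have := size_exp g (size p).+1; have sg0 : (0 < (size g).-1)%N by rewrite -subn1 subn_gt0.
  move/(congr1 (leq (size p).+1)); rewrite leq_pmull // leqNgt ltnS.
  by rewrite (leq_trans (leq_pred _) hle).
have [k nk mink] := ex_minnP ex; exists k; rewrite /has_multiplicity nk andbT.
case: k nk mink => [|k] _ mink; first by rewrite expr0 dvd1p.
by rewrite -[_ %| _]negbK; apply/negP => /mink; rewrite ltnn.
Qed.

(** If r were nonzero in r^2 p = c s^2, then [g] would have odd multiplicity on the left and even
    multiplicity on the right. *)
Lemma nonsquare_class_odd_multiplicity (p : {poly F}) k :
  odd k -> has_multiplicity g p k -> nonsquare_class p.
Proof.
move=> oddk hp r s c ers; apply/eqP; apply: contraT => r0.
have p0 : p != 0 by apply: contraTneq hp => ->; rewrite /has_multiplicity !dvdp0.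
have lhs0 : r ^+ 2 * p != 0 by rewrite mulf_neq0 ?expf_neq0.
move: lhs0; rewrite ers scaler_eq0 negb_or expf_eq0 /= => /andP[c0 s0].
have [i hi] := has_multiplicity_exists r0; have [j hj] := has_multiplicity_exists s0.
have h1 : has_multiplicity g (r ^+ 2 * p) (i + i + k).
  by apply: has_multiplicityM hp; apply: has_multiplicityM.
have h2 : has_multiplicity g (s ^+ 2) (j + j) by apply: has_multiplicityM.
have h3 : has_multiplicity g (r ^+ 2 * p) (j + j).
  by move: h2; rewrite ers /has_multiplicity !dvdpZr.
move: (congr1 odd (has_multiplicity_uniq h1 h3)).
by rewrite !oddD oddk !addbb.
Qed.

End Multiplicity.

Section Iterates.

Variables (F : fieldType) (f : {poly F}).

Lemma horner_poly_iterD i j (a : F) :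
  (poly_iter f (i + j)).[a] = (poly_iter f j).[(poly_iter f i).[a]].
Proof.
elim: j => [|j IH]; first by rewrite addn0 hornerX.
by rewrite addnS /= !horner_comp IH.
Qed.

Lemma size_poly_iter d n : size f = d.+1 -> (0 < d)%N ->
  size (poly_iter f n) = (d ^ n).+1.
Proof.
move=> sf d0; elim: n => [|n IH]; first by rewrite size_polyX.
have := size_comp_poly f (poly_iter f n); rewrite sf IH /= -expnS.
by case: size => [/esym/eqP|k /= ->//]; rewrite expn_eq0 eqn0Ngt d0.
Qed.

Lemma nonsquare_class_prod_iter n (J : {set 'I_n}) :
  dynamically_2_ordinary f -> J != set0 ->
  nonsquare_class (\prod_(j in J) poly_iter f j).
Proof.
move=> ord /set0Pn[j0 j0J]; have [N NJ maxN] := arg_maxnP (fun j : 'I_n => j : nat) j0J.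
have [g [irrg [k oddk hk] ng]] : exists g : {poly F}, [/\ irreducible_poly g,
    exists2 k, odd k & has_multiplicity g (poly_iter f N) k
    & forall i : nat, (i < N)%N -> ~~ (g %| poly_iter f i)].
  (* Ordinarity speaks only of indices from 1 on; for N = 0 the iterate is X, which is its own
     simple factor. *)
  have [N0|] := posnP N; last exact: ord.
  exists 'X; rewrite N0; split=> //; first by rewrite -['X]subr0; apply: irredp_XsubC.
  exists 1; rewrite // /has_multiplicity /= expr1 dvdpp /=.
  apply/negP => /(dvdp_leq _); rewrite polyX_eq0 size_polyXn size_polyX.
  by move/(_ isT).
apply: (nonsquare_class_odd_multiplicity irrg oddk).
(* The other factors have index below N, so [g] divides none of them and they add multiplicity 0. *)
rewrite (bigD1 N) //= -[k]addn0; apply: has_multiplicityM => //.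
rewrite /has_multiplicity expr0 dvd1p expr1 /=.
apply: (big_ind (fun p => ~~ (g %| p))) => [|p r np nr|j /andP[jJ jN]].
- by rewrite dvdp1; case: irrg => + _; case: size => [|[]].
- by rewrite irreducible_dvdM // negb_or np.
- by apply: ng; rewrite ltn_neqAle jN; apply: maxN.
Qed.

(** The degree is a sum of distinct powers of d with exponents below n, which is at most d^n because
    d >= 2. *)
Lemma size_prod_iter d n (J : {set 'I_n}) : size f = d.+1 -> (2 <= d)%N ->
  exists2 m, size (\prod_(j in J) poly_iter f j) = m.+1 & (m <= d ^ n)%N.
Proof.
move=> sf d2; have d0 : (0 < d)%N by apply: ltnW.
exists (\sum_(j in J) d ^ j)%N.
  rewrite size_prod; last by move=> j _; rewrite -size_poly_gt0 (size_poly_iter _ sf).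
  rewrite (eq_bigr (fun j : 'I_n => (d ^ j + 1)%N)) => [|j _]; last first.
    by rewrite (size_poly_iter _ sf) // addn1.
  by rewrite big_split sum1_card -addSn addnK.
apply: (@leq_trans (\sum_(j < n) d ^ j)%N).
  by rewrite [X in (_ <= X)%N](bigID (mem J)) leq_addr.
elim: n {J} => [|n IH]; first by rewrite big_ord0.
rewrite big_ord_recr /= expnS; apply: leq_trans (leq_add IH (leqnn _)) _.
by rewrite addnn -mul2n leq_mul2r d2 orbT.
Qed.

End Iterates.

(** * Counting consecutive squares *)

Lemma quad_char1 (F : finFieldType) : odd #|F| -> quad_char (1 : F) = 1.
Proof.
by move=> oddF; rewrite /quad_char expr1n eqxx (negPf (oner_neqN1 oddF)).
Qed.

Lemma sum_prod_quad_char_bound (F : finFieldType) (f : {poly F}) (d n l : nat) (eps : int) :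
  odd #|F| -> size f = d.+1 -> (2 <= d)%N -> dynamically_2_ordinary f ->
  (l * l <= #|F|)%N -> `|eps| = 1 ->
  l%:Z * \sum_(x : F) \prod_(j < n) (1 + eps * quad_char (poly_iter f j).[x]) <=
  (l * #|F| + 33 * d ^ n * 2 ^ n * #|F|)%:Z.
Proof.
move=> oddF sf d2 ord hl heps.
pose term (J : {set 'I_n}) :=
  eps ^+ #|J| * \sum_(x : F) quad_char (\prod_(j in J) poly_iter f j).[x].
have -> : \sum_(x : F) \prod_(j < n) (1 + eps * quad_char (poly_iter f j).[x]) =
    \sum_(J : {set 'I_n}) term J.
  rewrite [RHS](eq_bigr (fun J : {set 'I_n} => \sum_(x : F) \prod_(j < n)
      (if j \in J then eps * quad_char (poly_iter f j).[x] else 1))) => [|J _].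
    rewrite exchange_big; apply: eq_bigr => x _ /=.
    by rewrite -bigA_distr; apply: eq_bigr => j _; rewrite addrC.
  rewrite /term mulr_sumr; apply: eq_bigr => x _.
  rewrite -big_mkcond big_split /= prodr_const horner_prod.
  by rewrite (big_morph _ (quad_charM oddF) (quad_char1 oddF)).
(* The empty set gives the main term q. The other subsets, fewer than 2^n, fall under the character
   sum bound with m <= d^n. *)
rewrite (bigD1 set0) //= mulrDr PoszD; apply: lerD.
  rewrite /term cards0 expr0 mul1r big_set0.
  rewrite (eq_bigr (fun _ => 1%Z)) => [|x _]; last by rewrite hornerC quad_char1.
  by rewrite sumr_const PoszM -[#|F|%:Z]natz.
rewrite mulr_sumr; apply: (@le_trans _ _ (\sum_(J : {set 'I_n} | J != set0)
    (33 * d ^ n * #|F|)%:Z)).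
  apply: ler_sum => J J0; have [m sm hm] := size_prod_iter J sf d2.
  apply: le_trans (ler_norm _) _; rewrite normrM normrM normrX heps expr1n mul1r ger0_norm //.
  apply: le_trans (quad_char_sum_bound oddF sm (nonsquare_class_prod_iter ord J0) hl) _.
  by rewrite lez_nat leq_mul2r leq_mul2l hm !orbT.
rewrite sumr_const -mulr_natr natz -PoszM lez_nat [leqRHS]mulnAC leq_mul2l.
apply/orP; right.
have -> : (2 ^ n = #|powerset [set: 'I_n]|)%N by rewrite card_powerset cardsT card_ord.
by apply/subset_leq_card/subsetP => J _; rewrite powersetE subsetT.
Qed.

Lemma prod_ge_exp2 (n : nat) (w : 'I_n -> int) :
  (forall j, w j = 1 \/ w j = 2) -> (forall i j, w i = 1 -> w j = 1 -> i = j) ->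
  2 ^+ n.-1 <= \prod_(j < n) w j.
Proof.
move=> hw huniq; have [j0 /eqP wj0|w1] := pickP (fun j => w j == 1).
  rewrite (bigD1 j0) //= wj0 mul1r (eq_bigr (fun _ => 2)) => [|j jj0].
    by rewrite prodr_const (eq_card (B := predC1 j0)) // cardC1 card_ord.
  by case: (hw j) => // wj; move: jj0; rewrite (huniq _ _ wj wj0) eqxx.
rewrite (eq_bigr (fun _ => 2)) => [|j _]; last by case: (hw j) (w1 j) => // ->.
by rewrite prodr_const card_ord ler_weXn2l // leq_pred.
Qed.

Lemma quad_char_square (F : finFieldType) (x : F) : odd #|F| -> x != 0 ->
  quad_char x = if is_square x then 1 else -1.
Proof.
move=> oddF x0; rewrite is_square_exp // /quad_char.
have := oner_neqN1 oddF; case: (exp_half_card oddF x0) => ->; rewrite eqxx.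
  by move=> /negPf ->.
by rewrite eq_sym => /negPf ->.
Qed.

Lemma consecutive_nth (F : fieldType) (f : {poly F}) (a : F) (s : seq F) k j :
  consecutive_in_orbit f a s -> (k + j < size s)%N ->
  (poly_iter f j).[s`_k] = s`_(k + j).
Proof.
move=> [_ [i ->]]; rewrite size_mkseq => hkj.
rewrite !nth_mkseq //; last by apply: leq_ltn_trans hkj; rewrite leq_addr.
by rewrite addnA [RHS]horner_poly_iterD.
Qed.

(* A zero in the segment gives a factor 1 instead of 2, and as s has no
   repetitions this happens for at most one j. *)
Lemma consecutive_prod_ge (F : finFieldType) (f : {poly F}) (a : F) (s : seq F)
    (n k : nat) (eps : int) :
  odd #|F| -> consecutive_in_orbit f a s -> (k + n <= size s)%N ->
  eps = 1 /\ all (fun x => is_square x) s \/ eps = -1 /\ all (fun x => ~~ is_square x) s ->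
  2 ^+ n.-1 <= \prod_(j < n) (1 + eps * quad_char (poly_iter f j).[s`_k]).
Proof.
move=> oddF hs hk hsq.
have lt (j : 'I_n) : (k + j < size s)%N by apply: leq_trans hk; rewrite ltn_add2l.
have value (j : 'I_n) : 1 + eps * quad_char (poly_iter f j).[s`_k] =
    if s`_(k + j) == 0 then 1 else 2.
  rewrite (consecutive_nth hs (lt j)).
  case: eqP => [->|/eqP y0]; first by rewrite quad_char0 // mulr0 addr0.
  rewrite quad_char_square //.
  by case: hsq => [[-> /all_nthP/(_ _ (lt j))]|[-> /all_nthP/(_ _ (lt j))/negPf]] => ->.
apply: prod_ge_exp2 => [j|i j]; first by rewrite value; case: eqP; [left | right].
rewrite !value; case: eqP => // si _; case: eqP => // sj _; apply/val_inj => /=.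
have [us _] := hs; apply/eqP; rewrite -(eqn_add2l k) -(nth_uniq 0 _ _ us) ?lt //.
by rewrite si sj.
Qed.

(** The condition (2d)^n <= l keeps the error in [sum_prod_quad_char_bound] at 33 l q, comparable to
    the main term l q, while each admissible starting point weighs at least 2^(n-1). *)
Lemma consecutive_size_bound (F : finFieldType) (f : {poly F}) (a : F) (s : seq F)
    (d n l : nat) :
  odd #|F| -> size f = d.+1 -> (2 <= d)%N -> dynamically_2_ordinary f ->
  consecutive_in_orbit f a s ->
  all (fun x => is_square x) s \/ all (fun x => ~~ is_square x) s ->
  (l * l <= #|F|)%N -> ((2 * d) ^ n <= l)%N -> (2 ^ n * size s <= 69 * #|F|)%N.
Proof.
move=> oddF sf d2 ord hs hsq hl hn; have [us _] := hs.
have l0 : (0 < l)%N by apply: leq_trans hn; rewrite expn_gt0 muln_gt0 (ltnW d2).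
case: n hn => [|n] hn.
  rewrite mul1n -(card_uniqP us); apply: leq_trans (max_card _) _.
  by rewrite leq_pmull.
(* This pays for segments shorter than the window of n + 1 terms and, at the end, for the last n
   terms, which start no full window. *)
have n2q : (2 ^ n.+1 * n.+1 <= #|F|)%N.
  apply: leq_trans hl; apply: leq_trans (leq_pmulr l l0).
  apply: leq_trans hn; rewrite expnMn leq_mul2l; apply/orP; right.
  exact: ltnW (ltn_expl _ d2).
have [small|large] := ltnP (size s) n.+1.
  have : (2 ^ n.+1 * size s <= 2 ^ n.+1 * n.+1)%N by rewrite leq_mul2l ltnW ?orbT.
  by move: n2q; lia.
pose eps : int := if all (fun x => is_square x) s then 1 else -1.
have heps : eps = 1 /\ all (fun x => is_square x) s \/
            eps = -1 /\ all (fun x => ~~ is_square x) s.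
  rewrite /eps; case: ifP => h; first by left.
  by right; case: hsq => //; rewrite h.
have eps1 : `|eps| = 1 by rewrite /eps; case: ifP.
pose w (x : F) := \prod_(j < n.+1) (1 + eps * quad_char (poly_iter f j).[x]).
have w0 x : 0 <= w x.
  apply: prodr_ge0 => j _; rewrite /quad_char /eps.
  by case: ifP => _; do 2! case: (_ == _).
(* [T] holds the terms from which n + 1 successive terms stay inside [s]. They are distinct, and as
   [w] is nonnegative the sum may be restricted to them. *)
pose K := (size s - n)%N; pose T := [set x in take K s].
have cT : #|T| = K.
  by rewrite cardsE (card_uniqP (take_uniq _ us)) size_takel // leq_subr.
have lower : (2 ^ n * K)%:Z <= \sum_(x : F) w x.
  apply: (@le_trans _ _ (\sum_(x in T) w x)); last first.
    by rewrite [leRHS](bigID (mem T)) /= lerDl sumr_ge0.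
  apply: (@le_trans _ _ (\sum_(x in T) 2 ^+ n)).
    by rewrite sumr_const cT -[(2 ^ n * K)%N%:Z]natz natrM natrX mulr_natr.
  apply: ler_sum => x; rewrite inE => /(nthP 0)[k].
  rewrite size_takel ?leq_subr // => kK; rewrite nth_take // => <-.
  apply: (consecutive_prod_ge oddF hs) => //.
  by rewrite -(leq_sub2rE (p := n)); move: kK; rewrite /K; lia.
have := le_trans (ler_wpM2l (leq0n l : 0 <= l%:Z) lower)
  (sum_prod_quad_char_bound n.+1 oddF sf d2 ord hl eps1).
rewrite -PoszM lez_nat => hsum.
have : (2 ^ n * K <= 34 * #|F|)%N.
  rewrite -(leq_pmul2l l0); apply: leq_trans hsum _.
  have : (33 * d ^ n.+1 * 2 ^ n.+1 * #|F| <= 33 * l * #|F|)%N.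
    have -> : (33 * d ^ n.+1 * 2 ^ n.+1 * #|F| = 33 * (2 * d) ^ n.+1 * #|F|)%N.
      by rewrite expnMn -!mulnA; congr (_ * _)%N; rewrite mulnCA.
    by rewrite leq_mul2r leq_mul2l hn !orbT.
  by lia.
(* Twice 34 q, plus at most q for the last n terms, gives 69 q. *)
move: n2q; rewrite expnS.
have -> : size s = (K + n)%N by rewrite subnK // ltnW.
by lia.
Qed.

(** * Choice of parameters and passage to the real exponent *)

Lemma sqrt_bounds (q : nat) : exists l, (l * l <= q < l.+1 * l.+1)%N.
Proof.
elim: q => [|q [l /andP[h1 h2]]]; first by exists 0%N.
have [h|h] := ltnP q.+1 (l.+1 * l.+1)%N; first by exists l; rewrite leqW.
by exists l.+1; rewrite h /=; nia.
Qed.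

(** With L = log2 d, the upper bound on q reads q < 2^((2L+2)(n+1)), so 2^(n+1) exceeds q^(1/(2L+2))
    and q / 2^(n+1) is at most q^((2L+1)/(2L+2)). Passing from 2^n to 2^(n+1) doubles 69 to 138. *)
Lemma powR_exponent_bound (R : realType) (d n q N : nat) :
  (2 <= d)%N -> (0 < q)%N -> (q < ((2 * d) ^ n.+1) ^ 2)%N -> (2 ^ n * N <= 69 * q)%N ->
  N%:R <= 138 * (q%:R `^ ((2 * log2 (d%:R : R) + 1) / (2 * log2 (d%:R : R) + 2))).
Proof.
move=> d2 q0 hq hN.
have d0 : (0 : R) < d%:R by rewrite ltr0n ltnW.
have qR0 : (0 : R) < q%:R by rewrite ltr0n.
have ln2_gt0 : 0 < ln (2 : R) by rewrite ln_gt0 // ltr1n.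
have L0 : 0 <= log2 (d%:R : R) by rewrite divr_ge0 ?ln_ge0 ?ler1n ?(ltnW d2) // ltW.
have lnd : ln (d%:R : R) = log2 (d%:R : R) * ln 2 by rewrite divfK // gt_eqF.
set L := log2 _ in L0 lnd *.
have lnq : ln (q%:R : R) <= (2 * L + 2) * (n.+1%:R * ln 2).
  have : ln (q%:R : R) <= ln ((((2 * d) ^ n.+1) ^ 2)%N%:R).
    by rewrite ler_ln ?posrE ?ltr0n ?expn_gt0 ?muln_gt0 ?(ltnW d2) // ler_nat ltnW.
  rewrite -expnM natrX lnXn ?natrM ?mulr_gt0 // lnM ?posrE // lnd => /le_trans; apply.
  by rewrite -[_ *+ (n.+1 * 2)]mulr_natr natrM le_eqVlt; apply/orP; left; apply/eqP; ring.
have {}lnq : ln (q%:R : R) / (2 * L + 2) <= n.+1%:R * ln 2.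
  by rewrite ler_pdivrMr; [rewrite mulrC | lra].
have : q%:R / 2 ^+ n.+1 <= q%:R `^ ((2 * L + 1) / (2 * L + 2)).
  rewrite /powR gt_eqF // -{1}[q%:R]lnK ?posrE // -[2 in X in X <= _]lnK ?posrE //.
  rewrite -expRM_natl -expRN -expRD ler_expR.
  have -> : (2 * L + 1) / (2 * L + 2) * ln q%:R = ln (q%:R : R) - ln q%:R / (2 * L + 2).
    by field; lra.
  by rewrite lerD2l lerN2.
move=> hle; apply: le_trans (_ : 138 * (q%:R / 2 ^+ n.+1) <= _); last first.
  by rewrite ler_pM2l.
rewrite mulrA ler_pdivlMr ?exprn_gt0 // -natrX -!natrM ler_nat expnS; lia.
Qed.

Unset Implicit Arguments.

Theorem theorem4p6 (R : realType) (d : nat) (hd : (2 <= d)%N) :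
  exists C : R,
    forall (F : finFieldType) (f : {poly F}) (a : F) (s : seq F),
      odd #|F| ->
      size f = d.+1 ->
      dynamically_2_ordinary f ->
      consecutive_in_orbit f a s ->
      all (fun x => is_square x) s \/ all (fun x => ~~ is_square x) s ->
      (size s)%:R <=
        C * (#|F|%:R `^ ((2 * log2 (d%:R : R) + 1) / (2 * log2 (d%:R : R) + 2))).
Proof.
exists 138 => F f a s oddF sf ord hs hsq.
have q0 : (0 < #|F|)%N by apply: ltnW (finNzRing_gt1 F).
(* Here l is the integer part of sqrt q and n the largest exponent with (2d)^n <= l; maximality
   gives q < (l+1)^2 <= (2d)^(2(n+1)). *)
have [l /andP[hl1 hl2]] := sqrt_bounds #|F|.
have l0 : (0 < l)%N by rewrite lt0n; apply: contraTneq hl2 => ->; rewrite -leqNgt.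
have d1 : (1 < 2 * d)%N by rewrite mul2n -addnn; lia.
have /andP[hn1 hn2] := trunc_log_bounds d1 l0.
set n := trunc_log (2 * d) l in hn1 hn2.
apply: (@powR_exponent_bound R d n) => //.
  by apply: leq_trans hl2 _; rewrite -mulnn leq_mul.
exact: (consecutive_size_bound oddF sf hd ord hs hsq hl1 hn1).
Qed.
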